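(* Let $m$ be a positive integer and define, for $\tau\in\mathbb{H}$, $$\mathrm{KW}_m(\tau)=\frac{1}{4^m}\frac{1}{m!\left(\prod_{j=1}^m(2j-1)!\right)^2}\sum_{\substack{x_1,\dots,x_m\in\mathbb{Z}\\ y_1,\dots,y_m\in\frac12+\mathbb{Z}}}\prod_{j=1}^m\big(\operatorname{sgn}(x_j-y_j)-\operatorname{sgn}(-x_j-y_j)\big)\,V_m(\vec{\bm{x}})\prod_{j=1}^m q^{\frac12(x_j^2-y_j^2)}(-1)^{x_j-y_j-1/2}.$$ Then the following are equivalent: (i) the identity of power series in $q$ $$\triangle(q)^{2m(2m+1)}=\frac{1}{m!\left(\prod_{j=1}^m(2j-1)!\right)^2}\sum_{\substack{k_1,\dots,k_m\ge0\\ r_1,\dots,r_m\ge0}}(-1)^{k_1+\cdots+k_m}\prod_{1\le i<j\le m}(r_i+k_i-r_j-k_j)(r_i-r_j)(2+r_i+k_i+r_j+k_j)(1+r_i+r_j)\prod_{j=1}^m(1+2r_j)(1+r_j+k_j)\,q^{\sum_{j=1}^m(k_j^2+2k_jr_j+2k_j+r_j)-\frac{m(m-1)}{2}}$$ holds; (ii) $\theta_\triangle(\tau)^{2m(2m+1)}=\mathrm{KW}_m(\tau)$ for all $\tau\in\mathbb{H}$.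
   Context: $\triangle(q)=\sum_{n=0}^\infty q^{n(n+1)/2}$, and $\theta_\triangle(\tau)=q^{1/16}\triangle(q^{1/2})=\frac12\sum_{n\in\frac12+\mathbb{Z}}q^{n^2/4}$ with $q=e^{2\pi i\tau}$, $q^c=e^{2\pi ic\tau}$. For $\vec{\bm{x}}=(\bm{x}_1,\dots,\bm{x}_m)$, $\bm{x}_j=(x_j,y_j)$, $V_m(\vec{\bm{x}})=\prod_{1\le i<j\le m}(x_i^2-x_j^2)(y_i^2-y_j^2)\prod_{j=1}^mx_jy_j$. $\operatorname{sgn}$ is the sign function (its value at $0$ is never needed here). *)

(* Defs.v *)
From HB Require Import structures.
From mathcomp Require Import all_boot all_order all_algebra finmap.
From mathcomp Require Import complex.
From mathcomp Require Import boolp classical_sets functions cardinality fsbigop.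
From mathcomp Require Import reals topology normedtype sequences exp trigo.
From mathcomp.analysis.showcase Require Import summability.
Import Order.TTheory GRing.Theory Num.Theory.
Import numFieldNormedType.Exports.

Set Implicit Arguments.
Unset Strict Implicit.
Unset Printing Implicit Defensive.

Local Open Scope ring_scope.

(* m! * (prod_(1 <= j <= m) (2j-1)!)^2 *)
Definition norm_const (F : pzSemiRingType) (m : nat) : F :=
  (m`!)%:R * (\prod_(1 <= j < m.+1) ((2 * j - 1)`!)%:R) ^+ 2.
Arguments norm_const : clear implicits.

(* A formal series in q is given by its coefficients, indexed by nat (power
   series) or by int (Laurent series).  [formal_sum c e] is the formal series
   sum_i (c i) q^(e i): its coefficient at N is a sum over the fibre of [e] at
   N.  The sum over a set is 0 by convention when infinitely many of its terms
   are nonzero; this is never the case below, where all fibres are finite. *)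
Definition formal_sum (I : choiceType) (E : eqType) (c : I -> rat) (e : I -> E)
    (N : E) : rat :=
  \sum_(i \in [set i | e i = N]%classic) c i.

Definition fps_one (N : nat) : rat := (N == 0%N)%:R.
Definition fps_mul (f g : nat -> rat) (N : nat) : rat :=
  \sum_(i < N.+1) f i * g (N - i)%N.
Definition fps_exp (f : nat -> rat) (d : nat) : nat -> rat :=
  iter d (fps_mul f) fps_one.

Definition laurent_of_fps (f : nat -> rat) (N : int) : rat :=
  match N with Posz n => f n | Negz _ => 0 end.

Definition triangle_fps : nat -> rat :=
  formal_sum (fun _ : nat => 1) (fun n : nat => (n * n.+1)./2).

Definition kw_coef (m : nat)
    (p : {ffun 'I_m -> nat} * {ffun 'I_m -> nat}) : rat :=
  let k (j : 'I_m) : rat := (p.1 j)%:R in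
  let r (j : 'I_m) : rat := (p.2 j)%:R in
  (-1) ^+ (\sum_(j < m) p.1 j)%N *
  (\prod_(i < m) \prod_(j < m | (i < j)%N)
     ((r i + k i - r j - k j) * (r i - r j) *
      (2 + r i + k i + r j + k j) * (1 + r i + r j))) *
  \prod_(j < m) ((1 + 2 * r j) * (1 + r j + k j)).

(* The exponent can be negative, hence the values in int; it is so only where
   two of the r_j coincide, and then [kw_coef] vanishes. *)
Definition kw_expo (m : nat)
    (p : {ffun 'I_m -> nat} * {ffun 'I_m -> nat}) : int :=
  let k := p.1 in let r := p.2 in
  (\sum_(j < m) (k j ^ 2 + 2 * k j * r j + 2 * k j + r j))%N%:Z
  - ((m * (m - 1))./2)%N%:Z.

Definition kw_series (m : nat) (N : int) : rat :=
  (norm_const rat m)^-1 * formal_sum (@kw_coef m) (@kw_expo m) N.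

Local Open Scope complex_scope.

Section Analytic.
Variable R : realType.

Definition cexp (z : R[i]) : R[i] :=
  (expR (complex.Re z) * cos (complex.Im z))
    +i* (expR (complex.Re z) * sin (complex.Im z)).

(* q^c = e^(2 pi i c tau) *)
Definition qpow (tau : R[i]) (c : R) : R[i] :=
  cexp ((0 +i* (2 * pi * c)) * tau).

(* The topology on R[i] is the one of the normed space R[i]^o over itself. *)
Definition triangle (q : R[i]) : R[i] :=
  limn (series (fun n : nat => (q ^+ (n * n.+1)./2 : R[i]^o))).

Definition theta_triangle (tau : R[i]) : R[i] :=
  qpow tau (1 / 16) * triangle (qpow tau (1 / 2)).

Definition Vm (m : nat) (x y : 'I_m -> R) : R :=
  (\prod_(i < m) \prod_(j < m | (i < j)%N)
     ((x i ^+ 2 - x j ^+ 2) * (y i ^+ 2 - y j ^+ 2))) *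
  \prod_(j < m) (x j * y j).

(* The lattice point (x_j, y_j)_j of (Z x (1/2 + Z))^m is encoded by the
   integers p.1 j = x_j and p.2 j = y_j - 1/2, so that
   x_j - y_j - 1/2 = p.1 j - p.2 j - 1. *)
Definition KW_term (m : nat) (tau : R[i])
    (p : {ffun 'I_m -> int} * {ffun 'I_m -> int}) : R[i] :=
  let x (j : 'I_m) : R := (p.1 j)%:~R in
  let y (j : 'I_m) : R := (p.2 j)%:~R + 1 / 2 in
  (\prod_(j < m) (Num.sg (x j - y j) - Num.sg (- x j - y j)))%:C *
  (Vm x y)%:C *
  \prod_(j < m) (qpow tau (1 / 2 * (x j ^+ 2 - y j ^+ 2)) *
                 (-1) ^ (p.1 j - p.2 j - 1)).

(* [summability.sum] is the unconditional sum, i.e. the limit of the finite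
   partial sums along the directed set of finite sets of indices. *)
Definition KW (m : nat) (tau : R[i]) : R[i] :=
  (4 ^+ m)^-1 * (norm_const R[i] m)^-1 *
  summability.sum (fun p => (KW_term (m := m) tau p : R[i]^o)).

End Analytic.

(* Main.v *)
(* Put w = q^(1/2) and d = 2m(2m+1).  The summand of KW_m vanishes unless
   |x_j| > |y_j| for all j, and it is invariant under all sign changes, so
   substituting |x_j| = k_j + r_j + 1 and |y_j| = r_j + 1/2 (the signs contribute
   a factor 4^m) turns KW_m(tau) into q^(d/16) times the right-hand side of (i)
   evaluated at w, while theta_triangle(tau)^d = q^(d/16) triangle(w)^d.  All
   these sums converge absolutely for |w| < 1, so they may be regrouped by powers
   of w, and the equivalence becomes uniqueness of power series coefficients. *)
Require Import Defs.
From mathcomp Require Import all_boot all_order all_algebra.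
From mathcomp Require Import complex reals.
From mathcomp Require Import finmap boolp classical_sets functions cardinality.
From mathcomp Require Import fsbigop topology normedtype sequences exp trigo.
From mathcomp.analysis.showcase Require Import summability.
From mathcomp Require Import ring lra zify.
Import Order.TTheory GRing.Theory Num.Theory.
Import numFieldNormedType.Exports.
Local Open Scope ring_scope.

Set Implicit Arguments.
Unset Strict Implicit.
Unset Printing Implicit Defensive.

(** * Absolutely convergent unordered sums *)

(* Three kinds of infinite sum meet here: formal coefficients over fibres, limits of sequences of
   partial sums, and unconditional sums. The predicate [asum] links them all. Exponents in (i) can
   be negative before cancellation, so the series is evaluated with w^|exponent|. This alters no
   nonzero term: a nonzero coefficient forces the r_j to be distinct, hence r_1 + ... + r_m >=
   m(m-1)/2. Convergence holds because the exponent is, up to the constant shift, at least the sum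
   of all k_j + r_j, while the coefficients grow polynomially. The sign invariance is a cancellation
   of odd factors: the sgn difference gives 2 sgn(x_j), the power of -1 gives sgn(y_j), and V_m is
   odd in each variable. The remaining 2 turns |y_j| into 2r_j + 1. For (ii) => (i), the points tau
   on the imaginary axis suffice, since w then runs through the interval (0,1). *)
#[local] Existing Instance totally_filter.

(** The absolute bound is kept next to the limit because it is what yields the existence of product
    sums. A general [K] covers both R and the partially ordered field R[i]. *)
Definition asum (K : numFieldType) (I : choiceType) (c : I -> K) (s : K) :=
  (exists M : K, forall A : {fset I}, \sum_(i <- A) `|c i| <= M) /\
  (partial_sum (c : I -> K^o) @ totally --> (s : K^o))%classic.

Section AbsolutelyConvergentSums.
Variable K : numFieldType.
Implicit Types I J : choiceType.

Lemma partial_sumE I (V : zmodType) (c : I -> V) (A : {fset I}) :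
  partial_sum c A = \sum_(i <- A) c i.
Proof. by rewrite /partial_sum big_seq_fsetE. Qed.

Lemma asum_cvg I (c : I -> K) s : asum c s ->
  forall e, 0 < e -> exists A : {fset I}, forall B : {fset I},
    (A `<=` B)%fset -> `|s - \sum_(i <- B) c i| < e.
Proof.
move=> [_ /cvgrPdist_lt cs] e e0.
have /= [A _ HA] := cs e e0.
by exists A => B AB; have := HA B AB; rewrite /= partial_sumE.
Qed.

Lemma asum_intro I (c : I -> K) s (M : K) :
  (forall A : {fset I}, \sum_(i <- A) `|c i| <= M) ->
  (forall e, 0 < e -> exists A : {fset I}, forall B : {fset I},
    (A `<=` B)%fset -> `|s - \sum_(i <- B) c i| < e) ->
  asum c s.
Proof.
move=> cM H; split; first by exists M.
apply/cvgrPdist_lt => e e0.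
have [A HA] := H e e0.
by exists A => // B AB; rewrite /= partial_sumE; exact: HA.
Qed.

Lemma asum_unique I (c : I -> K) s t : asum c s -> asum c t -> s = t.
Proof.
move=> [_ cs] [_ ct].
exact: (@cvg_unique K^o (@norm_hausdorff _ _) _ _ _ _ cs ct).
Qed.

Lemma asum_sum I (c : I -> K) s : asum c s -> sum (c : I -> K^o) = s.
Proof. by move=> [_ cs]; apply: (@cvg_lim K^o) => //; exact: norm_hausdorff. Qed.

Lemma eq_asum I (c c' : I -> K) s : c =1 c' -> asum c s -> asum c' s.
Proof. by move=> /funext ->. Qed.

Lemma asumZ I (a : K) (c : I -> K) s : asum c s -> asum (fun i => a * c i) (a * s).
Proof.
move=> cs; have [[M cM] _] := cs.
apply: (@asum_intro _ _ _ (`|a| * M)).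
  move=> A; under eq_bigr do rewrite normrM.
  by rewrite -mulr_sumr; exact: ler_wpM2l.
move=> e e0.
have a1 : 0 < `|a| + 1 by rewrite ltr_wpDl.
have [|A HA] := asum_cvg cs (e := e / (`|a| + 1)); first exact: divr_gt0.
exists A => B /HA; rewrite ltr_pdivlMr // -mulr_sumr -mulrBr normrM => /le_lt_trans; apply.
by rewrite mulrC ler_wpM2l // lerDl.
Qed.

Lemma asumB I (c d : I -> K) s t : asum c s -> asum d t ->
  asum (fun i => c i - d i) (s - t).
Proof.
move=> cs dt; have [[M cM] _] := cs; have [[N dN] _] := dt.
apply: (@asum_intro _ _ _ (M + N)).
  move=> A; apply: le_trans (lerD (cM A) (dN A)).
  by rewrite -big_split; apply: ler_sum => i _; exact: ler_normB.
move=> e e0; have e2 : 0 < e / 2 by rewrite divr_gt0.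
have [A HA] := asum_cvg cs e2; have [B HB] := asum_cvg dt e2.
exists (A `|` B)%fset => D; rewrite fsubUset => /andP[/HA hA /HB hB].
rewrite sumrB.
have -> : s - t - (\sum_(i <- D) c i - \sum_(i <- D) d i) =
  (s - \sum_(i <- D) c i) - (t - \sum_(i <- D) d i) by ring.
by rewrite (le_lt_trans (ler_normB _ _)) // (splitr e) ltrD.
Qed.

Lemma fset_prod_cover I J (A : {fset I * J}) :
  (A `<=` [fset x.1 | x in A] `*` [fset x.2 | x in A])%fset.
Proof.
apply/fsubsetP => x xA; rewrite in_fsetM.
by apply/andP; split; apply/imfsetP; exists x.
Qed.

Lemma sumr_fset_le I (F : I -> K) (A B : {fset I}) :
  (forall i, 0 <= F i) -> (A `<=` B)%fset ->
  \sum_(i <- A) F i <= \sum_(i <- B) F i.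
Proof.
move=> F0 AB; rewrite [leRHS](big_fsetID _ (fun i => i \in A)) /=.
have -> : [fset x in B | x \in A]%fset = A.
  by apply/fsetP => x; rewrite !inE /= andb_idl // => /(fsubsetP AB).
by rewrite lerDl sumr_ge0.
Qed.

Lemma sum_fsetM I J (f : I -> K) (g : J -> K) (A : {fset I}) (B : {fset J}) :
  \sum_(x <- (A `*` B)%fset) f x.1 * g x.2 =
  (\sum_(i <- A) f i) * (\sum_(j <- B) g j).
Proof.
rewrite big_distrl /=; under [RHS]eq_bigr do rewrite big_distrr /=.
by rewrite big_imfset2 // => -[x1 y1] [x2 y2] /= _ _ [-> ->].
Qed.

(** Rectangles are cofinal among the finite sets of pairs, so the products of partial sums tend both
    to [u] and to [s * t]. The existence of [u] is assumed because [K] may be incomplete. *)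
Lemma asum_mul_eq I J (f : I -> K) (g : J -> K) s t u :
  asum f s -> asum g t -> asum (fun x => f x.1 * g x.2) u -> u = s * t.
Proof.
move=> [_ fs] [_ gt] fgu.
pose F := filter_prod (@totally I) (@totally J).
have FF : ProperFilter F by exact: filter_prod_proper.
have p1 : (partial_sum (f : I -> K^o) P.1 @[P --> F] --> (s : K^o))%classic.
  exact: cvg_comp cvg_fst fs.
have p2 : (partial_sum (g : J -> K^o) P.2 @[P --> F] --> (t : K^o))%classic.
  exact: cvg_comp cvg_snd gt.
apply: esym; apply: (@cvg_unique K^o (@norm_hausdorff _ _) _ _ _ _ (@cvgM K _ F _ _ _ _ _ p1 p2)).
apply/cvgrPdist_lt => e e0.
have [A HA] := asum_cvg fgu e0.
exists ([set B | [fset x.1 | x in A] `<=` B]%fset,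
        [set B | [fset x.2 | x in A] `<=` B]%fset)%classic.
  by split; [exists [fset x.1 | x in A]%fset|exists [fset x.2 | x in A]%fset].
move=> [B D] [/= AB AD]; rewrite !partial_sumE -sum_fsetM; apply: HA.
apply: fsubset_trans (fset_prod_cover A) _.
apply/fsubsetP => x; rewrite !in_fsetM => /andP[x1 x2].
by rewrite (fsubsetP AB) // (fsubsetP AD).
Qed.

Lemma bounded_sumM I J (f : I -> K) (g : J -> K) (M N : K) :
  (forall A : {fset I}, \sum_(i <- A) `|f i| <= M) ->
  (forall A : {fset J}, \sum_(i <- A) `|g i| <= N) ->
  forall A : {fset I * J}, \sum_(i <- A) `|f i.1 * g i.2| <= M * N.
Proof.
move=> fM gN A.
apply: le_trans (sumr_fset_le _ (fset_prod_cover A)) _ => //.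
under eq_bigr do rewrite normrM.
rewrite (@sum_fsetM _ _ (fun i => `|f i|) (fun i => `|g i|)).
by apply: ler_pM => //; exact: sumr_ge0.
Qed.

Section Regrouping.
Variables (I J : choiceType) (e : I -> J).
Hypothesis fin_e : forall j, finite_set [set i | e i = j]%classic.

Let preim_e (B : {fset J}) : {fset I} :=
  (\bigcup_(j <- B) fset_set [set i | e i = j]%classic)%fset.

Let mem_preim_e B i : (i \in preim_e B) = (e i \in B).
Proof.
apply/bigfcupP/idP => [[j /andP[jB _]]|eiB].
  by rewrite in_fset_set // inE /= => ->.
by exists (e i); rewrite ?eiB // in_fset_set // inE.
Qed.

Let sum_preim_e (V : nmodType) (c : I -> V) (B : {fset J}) :
  \sum_(j <- B) \sum_(i \in [set i | e i = j]%classic) c i =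
  \sum_(i <- preim_e B) c i.
Proof.
rewrite [RHS](partition_big_imfset _ e) /=.
have sub : ([fset e x | x in preim_e B] `<=` B)%fset.
  by apply/fsubsetP => _ /imfsetP[i /= iB ->]; rewrite -mem_preim_e.
rewrite [RHS](big_fset_incl _ sub) => [|j jB jNe]; last first.
  rewrite big_seq_cond big1 // => i /andP[iB /eqP eij].
  by case/negP: jNe; apply/imfsetP; exists i.
apply: eq_big_seq => j jB.
rewrite fsbig_finite // [RHS]big_fset_condE; apply: eq_fbigl => i.
rewrite in_fset_set // !inE /= mem_preim_e.
by apply/asboolP/andP => [->|[_ /eqP//]]; rewrite eqxx.
Qed.

(** As the fibres are finite, the preimage of a finite set is finite: each partial sum of the fibre
    sums is a partial sum of [c], and no iterated limit occurs. *)
Lemma asum_fibre (c : I -> K) s : asum c s ->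
  asum (fun j => \sum_(i \in [set i | e i = j]%classic) c i) s.
Proof.
move=> cs; have [[M cM] _] := cs.
apply: (@asum_intro _ _ _ M) => [B|eps eps0].
  apply: le_trans (cM (preim_e B)); rewrite -sum_preim_e.
  by apply: ler_sum => j _; rewrite !fsbig_finite //; exact: ler_norm_sum.
have [A HA] := asum_cvg cs eps0.
exists [fset e i | i in A]%fset => B AB; rewrite sum_preim_e; apply: HA.
apply/fsubsetP => i iA; rewrite mem_preim_e (fsubsetP AB) //.
by apply/imfsetP; exists i.
Qed.

End Regrouping.

(** The image of the injection [f] contains the support of [c]; [h A] pulls back the part of [A]
    inside this image. *)
Lemma asum_reindex I J (f : J -> I) (g : I -> J) (c : I -> K) s :
  cancel f g -> (forall i, c i != 0 -> f (g i) = i) ->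
  asum (c \o f) s -> asum c s.
Proof.
move=> fK gK cs; have [[M cM] _] := cs.
pose h (A : {fset I}) := [fset g i | i in [fset i in A | f (g i) == i]]%fset.
have sumh (V : nmodType) (d : I -> V) (A : {fset I}) :
    (forall i, c i = 0 -> d i = 0) ->
    \sum_(i <- A) d i = \sum_(j <- h A) d (f j).
  move=> cd; rewrite big_imfset /=; last first.
    by move=> i1 i2; rewrite !inE => /andP[_ /eqP<-] /andP[_ /eqP<-]; rewrite !fK => ->.
  rewrite (big_fsetID _ (fun i => f (g i) == i)) /= [X in _ + X]big_seq_cond.
  rewrite [X in _ + X]big1 ?addr0 => [|i].
    by apply: eq_big_seq => i; rewrite !inE => /andP[_ /eqP->].
  rewrite !inE andbT => /andP[_ /eqP fgi]; apply: cd.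
  by apply/eqP; apply: contrapT => /negP /gK.
apply: (@asum_intro _ _ _ M) => [A|e e0].
  by rewrite sumh => [|i ->]; [exact: cM|rewrite normr0].
have [A HA] := asum_cvg cs e0.
exists [fset f j | j in A]%fset => B AB; rewrite sumh //; apply: HA.
apply/fsubsetP => j jA; apply/imfsetP; exists (f j); rewrite ?fK //= !inE fK eqxx.
by rewrite andbT (fsubsetP AB) //; apply/imfsetP; exists j.
Qed.

Lemma asum_finite (T : finType) (c : T -> K) : asum c (\sum_t c t).
Proof.
have full (A : {fset T}) : ([fset t | t in T] `<=` A)%fset -> A = [fset t | t in T]%fset.
  by move=> TA; apply/eqP; rewrite eqEfsubset TA andbT; apply/fsubsetP => t _; rewrite !inE.
have sumT (d : T -> K) : \sum_(t <- [fset t | t in T]%fset) d t = \sum_t d t.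
  by rewrite big_imfset //= big_enum.
apply: (@asum_intro _ _ _ (\sum_t `|c t|)) => [A|e e0].
  by rewrite -sumT; apply: sumr_fset_le => //; apply/fsubsetP => t _; rewrite !inE.
by exists [fset t | t in T]%fset => B /full ->; rewrite sumT subrr normr0.
Qed.

Lemma big_ord_fset (V : nmodType) (g : nat -> V) n :
  \sum_(k < n) g k = \sum_(k <- [fset nat_of_ord i | i in [set: 'I_n]%SET]%fset) g k.
Proof.
rewrite big_imfset /=; last by move=> i j _ _ /val_inj.
by rewrite big_enum /=; apply: eq_bigl => i; rewrite inE.
Qed.

Lemma fsubset_ord (A : {fset nat}) n : (\max_(k <- A) k < n)%N ->
  (A `<=` [fset nat_of_ord i | i in [set: 'I_n]%SET])%fset.
Proof.
move=> An; apply/fsubsetP => k kA.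
have k_n : (k < n)%N by apply: leq_ltn_trans An; exact: leq_bigmax_seq.
by apply/imfsetP; exists (Ordinal k_n); rewrite ?inE.
Qed.

Lemma asum_series (c : nat -> K) s :
  asum c s -> limn (series (c : nat -> K^o)) = (s : K^o).
Proof.
move=> cs; apply: (@cvg_lim K^o) => //.
apply/cvgrPdist_lt => e e0; have [A HA] := asum_cvg cs e0.
exists (\max_(i <- A) i).+1 => // n /= An.
rewrite /series /= big_mkord (big_ord_fset (c : nat -> K^o)).
by apply: HA; exact: fsubset_ord.
Qed.

End AbsolutelyConvergentSums.

(** * Real and complex sums: existence, products, power series *)

Section ComplexSums.
Variables (R : realType).
Implicit Type I : choiceType.
Local Open Scope complex_scope.

Lemma asum_exists_ge0 I (c : I -> R) (M : R) : (forall i, 0 <= c i) ->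
  (forall A : {fset I}, \sum_(i <- A) c i <= M) -> exists s, asum c s.
Proof.
move=> c0 cM.
pose E : set R := [set \sum_(i <- A) c i | A in [set: {fset I}]]%classic.
have supE : has_sup E.
  split; first by exists (\sum_(i <- (fset0 : {fset I})) c i); exists fset0.
  by exists M => _ [A _ <-].
exists (sup E); apply: (@asum_intro _ _ _ _ M) => [A|e e0].
  by under eq_bigr do rewrite ger0_norm //.
have [_ [A _ <-] HA] := sup_adherent e0 supE.
exists A => B AB.
have AB' := sumr_fset_le c0 AB.
have BE : \sum_(i <- B) c i <= sup E by apply: ub_le_sup; [case: supE|exists B].
by rewrite ger0_norm ?subr_ge0 //; lra.
Qed.

Lemma asum_exists_real I (c : I -> R) (M : R) :
  (forall A : {fset I}, \sum_(i <- A) `|c i| <= M) -> exists s, asum c s.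
Proof.
move=> cM.
have [s hs] : exists s, asum (fun i => `|c i|) s by exact: asum_exists_ge0 cM.
have [t ht] : exists s, asum (fun i => `|c i| - c i) s.
  apply: (@asum_exists_ge0 _ _ (M + M)) => [i|A]; first by rewrite subr_ge0 ler_norm.
  apply: le_trans (lerD (cM A) (cM A)); rewrite -big_split.
  by apply: ler_sum => i _; rewrite lerD2l -normrN ler_norm.
by exists (s - t); apply: eq_asum (asumB hs ht) => i; rewrite opprB addrC subrK.
Qed.

Lemma asum_real_complex I (c : I -> R) s :
  asum c s -> asum (fun i => (c i)%:C) s%:C.
Proof.
move=> cs; have [[M cM] _] := cs.
have normC (x : R) : `|x%:C| = `|x|%:C by rewrite normc_def /= expr0n addr0 sqrtr_sqr.
apply: (@asum_intro _ _ _ _ M%:C) => [A|e].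
  by under eq_bigr do rewrite normC; rewrite -rmorph_sum lecR.
rewrite ltcE /= => /andP[/eqP ime e0].
have [A HA] := asum_cvg cs e0.
exists A => B /HA; rewrite -rmorph_sum -rmorphB normC.
by rewrite ltcE /= ime eqxx.
Qed.

Lemma asum_exists I (c : I -> R[i]) (M : R) :
  (forall A : {fset I}, \sum_(i <- A) `|c i| <= M%:C) -> exists s, asum c s.
Proof.
move=> cM.
have bound (u : I -> R) : (forall i, `|u i|%:C <= `|c i|) ->
    exists s, asum (fun i => (u i)%:C) s.
  move=> uc; have [s /asum_real_complex us] : exists s, asum u s.
    apply: (@asum_exists_real _ _ M) => A; rewrite -lecR rmorph_sum /=.
    by apply: le_trans (cM A); apply: ler_sum.
  by exists s%:C.
have [s hs] : exists s, asum (fun i => (complex.Re (c i))%:C) s.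
  by apply: bound => i; exact: normc_ge_Re.
have [t ht] : exists t, asum (fun i => (complex.Im (c i))%:C) t.
  (* Im z = - Re (i z) and |i z| = |z|. *)
  apply: bound => i; have := normc_ge_Re ('i%C * c i).
  rewrite [X in _ <= X]normrM [X in _ <= X * _]normc_def /= expr0n expr1n add0r sqrtr1 mul1r.
  by case: (c i) => a b /=; rewrite mul0r mul1r sub0r normrN.
exists (s - (- 'i%C) * t); apply: eq_asum (asumB hs (asumZ (- 'i%C) ht)) => i.
by rewrite mulNr opprK -complexE.
Qed.

Lemma asum_bounded I (c : I -> R[i]) s : asum c s ->
  exists M : R, forall A : {fset I}, \sum_(i <- A) `|c i| <= M%:C.
Proof.
move=> [[M cM] _]; exists (complex.Re M) => A; apply: le_trans (cM A) _.
(* In the order of R[i], 0 <= M forces M to be real. *)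
have := le_trans (sumr_ge0 _ _) (cM fset0) : 0 <= M.
move=> /(_ (fun i _ => normr_ge0 (c i))).
by rewrite !lecE => /andP[/eqP] ->; rewrite eqxx lexx.
Qed.

Lemma asum_mul I (J : choiceType) (f : I -> R[i]) (g : J -> R[i]) s t :
  asum f s -> asum g t -> asum (fun x => f x.1 * g x.2) (s * t).
Proof.
move=> fs gt; have [M fM] := asum_bounded fs; have [N gN] := asum_bounded gt.
have [u fgu] : exists u, asum (fun x => f x.1 * g x.2) u.
  apply: (@asum_exists _ _ (M * N)) => A; rewrite rmorphM.
  exact: bounded_sumM.
by rewrite -(asum_mul_eq fs gt fgu).
Qed.

(** Cauchy product: the pairs are regrouped along the antidiagonals. *)
Lemma asum_fps_mul (f g : nat -> rat) (z s t : R[i]) :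
  asum (fun n => ratr (f n) * z ^+ n) s -> asum (fun n => ratr (g n) * z ^+ n) t ->
  asum (fun n => ratr (fps_mul f g n) * z ^+ n) (s * t).
Proof.
move=> fs gt; pose e (x : nat * nat) := (x.1 + x.2)%N.
have bij n : set_bij `I_n.+1 [set x | e x = n] (fun i => (i, n - i)%N).
  split.
  - by move=> i /= i_n; rewrite /e /= subnKC.
  - by move=> i j _ _ [].
  - move=> [i j] /= <-; exists i; rewrite /e /= ?addKn //.
    by rewrite ltnS leq_addr.
have fin_e n : finite_set [set x | e x = n]%classic.
  have [_ _ surj] := bij n.
  exact: sub_finite_set surj (finite_image _ (finite_II n.+1)).
apply: eq_asum (asum_fibre fin_e (asum_mul fs gt)) => n /=.
rewrite (reindex_fsbig _ _ _ _ (bij n)) -fsbig_ord /fps_mul rmorph_sum mulr_suml.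
apply: eq_bigr => i _ /=; rewrite rmorphM /= -mulrA [z ^+ _ * _]mulrCA.
by rewrite -exprD subnKC 1?mulrA // -ltnS.
Qed.

Lemma asum_fps_exp (f : nat -> rat) (z s : R[i]) d :
  asum (fun n => ratr (f n) * z ^+ n) s ->
  asum (fun n => ratr (fps_exp f d n) * z ^+ n) (s ^+ d).
Proof.
move=> fs; elim: d => [|d IHd]; last by rewrite exprS; exact: asum_fps_mul.
(* [fps_one] is supported at 0, so its series is a sum over [unit]. *)
apply: (@asum_reindex _ _ _ (fun=> 0%N) (fun=> tt)) => [[]//|n|].
  by rewrite /fps_exp /= /fps_one; case: n => //= n; rewrite rmorph0 mul0r eqxx.
have := asum_finite (fun t : unit => 1 : R[i]); rewrite big_const card_unit /= addr0.
by apply: eq_asum => t /=; rewrite expr0 rmorph1 mulr1.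
Qed.

End ComplexSums.

(** * Exponentials and majorants *)

Section Exponential.
Variable R : realType.
Local Open Scope complex_scope.
Implicit Types (tau z : R[i]) (c : R).

Lemma cexpD z z' : cexp (z + z') = cexp z * cexp z'.
Proof.
case: z z' => [a b] [a' b']; rewrite /cexp /= expRD sinD cosD.
by apply/eqP; rewrite eq_complex /=; apply/andP; split; apply/eqP; ring.
Qed.

Lemma qpowD tau c c' : qpow tau (c + c') = qpow tau c * qpow tau c'.
Proof.
rewrite /qpow -cexpD; congr cexp; case: tau => x y; set k := 2 * pi.
by rewrite mulrDr; apply/eqP; rewrite eq_complex; apply/andP; split; apply/eqP => /=; ring.
Qed.

Lemma norm_qpow tau c : `|qpow tau c| = (expR (- (2 * pi * c * complex.Im tau)))%:C.
Proof.
case: tau => x y; rewrite normc_def /qpow /cexp /= mul0r sub0r.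
by rewrite !exprMn -mulrDr cos2Dsin2 mulr1 sqrtr_sqr gtr0_norm ?expR_gt0.
Qed.

Lemma qpow_neq0 tau c : qpow tau c != 0.
Proof. by rewrite -normr_eq0 norm_qpow eq_complex /= negb_and gt_eqF ?expR_gt0. Qed.

Lemma qpow0 tau : qpow tau 0 = 1.
Proof. by apply: (mulfI (qpow_neq0 tau 0)); rewrite -qpowD addr0 mulr1. Qed.

Lemma qpow_sum tau (I : Type) (r : seq I) (P : pred I) (f : I -> R) :
  qpow tau (\sum_(i <- r | P i) f i) = \prod_(i <- r | P i) qpow tau (f i).
Proof. exact: (big_morph _ (qpowD tau) (qpow0 tau)). Qed.

Lemma qpow_natl tau c n : qpow tau (n%:R * c) = qpow tau c ^+ n.
Proof.
elim: n => [|n IHn]; first by rewrite mul0r qpow0 expr0.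
by rewrite exprS -IHn -qpowD -natr1 mulrDl mul1r addrC.
Qed.

End Exponential.

Section Bounds.
Variable R : realType.
Implicit Types rho : R.

Lemma geometric_sum_le rho n : 0 < rho < 1 -> \sum_(k < n) rho ^+ k <= (1 - rho)^-1.
Proof.
move=> /andP[r0 r1]; have d0 : 0 < 1 - rho by rewrite subr_gt0.
rewrite -[leRHS]mul1r ler_pdivlMr // mulrC -opprB mulNr -subrX1 opprB.
by rewrite gerBl exprn_ge0 // ltW.
Qed.

(* A power of [k.+1] is dominated by a power of [rho^(-1/2)]. *)
Lemma polynomial_geometric_sum_le rho M : 0 < rho < 1 ->
  exists B, forall n, \sum_(k < n) k.+1%:R ^+ M * rho ^+ k <= B.
Proof.
move=> /andP[r0 r1].
pose a := - ln rho; have a0 : 0 < a by rewrite oppr_gt0 ln_lt0 // r0.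
(* Chosen so that exp(d(k+1))^(M+1) = s^-(k+1), to be compared with d(k+1) <= exp(d(k+1)). Dividing
   by M+1 rather than M covers M = 0. *)
pose d := a / 2 / M.+1%:R; have d0 : 0 < d by rewrite !divr_gt0 // ltr0n.
pose s := expR (- (a / 2)); have s0 : 0 < s by exact: expR_gt0.
have s1 : s < 1 by rewrite -expR0 ltr_expR; lra.
have rs : rho = s * s by rewrite -expRD -[LHS]lnK ?posrE //; congr expR; rewrite /a; lra.
have poly_le k : k.+1%:R ^+ M <= d ^- M * s ^- k.+1.
  rewrite -ler_pdivrMl ?invr_gt0 ?exprn_gt0 // invrK -exprMn.
  have -> : s ^- k.+1 = expR (d * k.+1%:R) ^+ M.+1.
    rewrite -expRM_natl -exprVn -expRN opprK -expRM_natl /d; congr expR.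
    by field; rewrite nat1r pnatr_eq0.
  have dk0 : 0 <= d * k.+1%:R := mulr_ge0 (ltW d0) (ler0n _ _).
  have ge1 : 1 <= expR (d * k.+1%:R) by rewrite -[leLHS]expR0 ler_expR.
  have := expR_ge1Dx (d * k.+1%:R) => le1.
  apply: (@le_trans _ _ (expR (d * k.+1%:R) ^+ M)); last exact: ler_weXn2l.
  apply: lerXn2r; rewrite ?nnegrE ?expR_ge0 //.
  by apply: le_trans le1; rewrite lerDr ler01.
exists (d ^- M * s^-1 * (1 - s)^-1) => n.
apply: (@le_trans _ _ (\sum_(k < n) (d ^- M * s^-1) * s ^+ k)).
  apply: ler_sum => k _.
  apply: (@le_trans _ _ (d ^- M * s ^- k.+1 * rho ^+ k)).
    by rewrite ler_wpM2r // exprn_ge0 // ltW.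
  have sk0 : s ^+ k != 0 by rewrite expf_neq0 // gt_eqF.
  rewrite -!mulrA [X in _ * X <= _](_ : _ = s^-1 * s ^+ k) // rs exprMn.
  by rewrite exprS invfM -mulrA mulKf.
rewrite -mulr_sumr ler_wpM2l ?geometric_sum_le ?s0 //.
by rewrite mulr_ge0 // invr_ge0 ?exprn_ge0 // ltW.
Qed.

Lemma sumr_fset_finType_le (T : finType) (F : T -> R) (A : {fset T}) :
  (forall t, 0 <= F t) -> \sum_(t <- A) F t <= \sum_t F t.
Proof.
move=> F0; rewrite big_uniq ?fset_uniq //= big_mkcond; apply: ler_sum => t _.
by case: ifP.
Qed.

(** A finite set of tuples lies in a box, over which the sum of products is the m-th power of a
    one-variable sum. *)
Lemma sumr_fset_ffun_le m (g : nat -> R) (B : R) :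
  (forall n, 0 <= g n) -> (forall n, \sum_(k < n) g k <= B) ->
  forall A : {fset {ffun 'I_m -> nat}},
  \sum_(f <- A) \prod_(j < m) g (f j) <= B ^+ m.
Proof.
move=> g0 gB A.
pose N := \max_(f <- A) \max_(j < m) f j.
have fN f j : f \in A -> (f j < N.+1)%N.
  move=> fA; rewrite ltnS; apply: leq_trans (leq_bigmax_seq _ fA _) => //.
  exact: (leq_bigmax j).
pose phi (f : {ffun 'I_m -> nat}) : {ffun 'I_m -> 'I_N.+1} := [ffun j => inord (f j)].
have phiE f j : f \in A -> phi f j = f j :> nat by move=> fA; rewrite ffunE inordK ?fN.
have -> : \sum_(f <- A) \prod_(j < m) g (f j) =
    \sum_(h <- [fset phi f | f in A]%fset) \prod_(j < m) g (h j).
  rewrite big_imfset /=; last first.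
    move=> f1 f2 A1 A2 /ffunP eq12; apply/ffunP => j.
    by rewrite -!phiE // eq12.
  by apply: eq_big_seq => f fA; apply: eq_bigr => j _; rewrite phiE.
apply: le_trans (sumr_fset_finType_le _ _) _ => [h|]; first exact: prodr_ge0.
rewrite -(bigA_distr_bigA (fun (_ : 'I_m) (k : 'I_N.+1) => g k)).
rewrite prodr_const card_ord; apply: lerXn2r => //; rewrite nnegrE.
  exact: sumr_ge0.
by apply: le_trans (gB 0); rewrite big_ord0.
Qed.

End Bounds.

(** * Coefficients and exponents of the series in (i) *)

Section SeriesKW.
Variable m : nat.
Notation index := ({ffun 'I_m -> nat} * {ffun 'I_m -> nat})%type.
Implicit Type p : index.

Definition kw_weight p : nat :=
  (\sum_(j < m) (p.1 j ^ 2 + 2 * p.1 j * p.2 j + 2 * p.1 j + p.2 j))%N.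

(** A majorant that is a product over coordinates, so that bounds by its powers split into
    one-variable sums. *)
Definition kw_size p : rat := \prod_(j < m) ((p.1 j).+1%:R * (p.2 j).+1%:R).

Lemma kw_expoE p : kw_expo p = (kw_weight p)%:Z - ((m * (m - 1))./2)%N%:Z.
Proof. by []. Qed.

Lemma kw_size_ge1 p (P : pred 'I_m) :
  1 <= \prod_(j < m | P j) ((p.1 j).+1%:R * (p.2 j).+1%:R) :> rat.
Proof.
apply: (big_ind (fun x : rat => 1 <= x)) => // [x y x1 y1|j _].
  by rewrite -[1]mulr1 ler_pM.
by rewrite -[leLHS]mulr1 ler_pM ?ler1n.
Qed.

Lemma le_kw_size p j : (p.1 j).+1%:R * (p.2 j).+1%:R <= kw_size p.
Proof. by rewrite /kw_size (bigD1 j) //= ler_peMr ?mulr_ge0 ?kw_size_ge1. Qed.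

Lemma le_kw_size2 p i j : i != j ->
  ((p.1 i).+1%:R * (p.2 i).+1%:R) * ((p.1 j).+1%:R * (p.2 j).+1%:R) <= kw_size p.
Proof.
move=> ij; rewrite /kw_size (bigD1 i) //= (bigD1 j) 1?eq_sym //= ler_wpM2l ?mulr_ge0 //.
by rewrite ler_peMr ?mulr_ge0 ?kw_size_ge1.
Qed.

(** With U = [kw_size p], the four factors of a pair i < j are at most U, U, 2U, U, since (1 + k_i +
    r_i)(1 + k_j + r_j) <= U. The pairs with i >= j are padded by 1 <= W, which gives m * m; the
    last product gives m more. *)
Lemma norm_kw_coef_le p : `|kw_coef p| <= (2 * kw_size p ^+ 4) ^+ (m * m + m).
Proof.
set U := kw_size p; set W := 2 * U ^+ 4.
have U1 : 1 <= U by exact: kw_size_ge1.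
have W1 : 1 <= W by rewrite -[leLHS]mulr1 ler_pM ?exprn_ege1 // ler1n.
rewrite /kw_coef !normrM normrX normrN1 expr1n mul1r exprD; apply: ler_pM => //.
- rewrite normr_prod exprM.
  have -> : (W ^+ m) ^+ m = \prod_(i < m) \prod_(j < m) W by rewrite !prodr_const !card_ord.
  apply: ler_prod => i _; rewrite normr_ge0 normr_prod big_mkcond /=.
  apply: ler_prod => j _; case: ifP => [ij|_]; last by rewrite ler01.
  rewrite normr_ge0 /=.
  have := le_kw_size2 p (_ : i != j); rewrite -val_eqE neq_ltn ij => /(_ isT).
  rewrite -/U -!nat1r !normrM.
  move: (p.1 i)%:R (p.1 j)%:R (p.2 i)%:R (p.2 j)%:R
    (ler0n rat (p.1 i)) (ler0n rat (p.1 j)) (ler0n rat (p.2 i)) (ler0n rat (p.2 j)).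
  move=> ki kj ri rj ki0 kj0 ri0 rj0 leU.
  have leU' : (1 + (ki + ri)) * (1 + (kj + rj)) <= U.
    apply: le_trans leU; apply: ler_pM; nra.
  have prod0 : 0 <= (ki + ri) * (kj + rj) by rewrite mulr_ge0 ?addr_ge0.
  have b1 : `|ri + ki - rj - kj| <= U by rewrite ler_norml; apply/andP; split; lra.
  have b2 : `|ri - rj| <= U by rewrite ler_norml; apply/andP; split; lra.
  have b3 : `|2 + ri + ki + rj + kj| <= 2 * U by rewrite ger0_norm; lra.
  have b4 : `|1 + ri + rj| <= U by rewrite ger0_norm; lra.
  have -> : W = U * U * (2 * U) * U by rewrite /W; ring.
  by rewrite !ler_pM ?mulr_ge0.
- rewrite normr_prod.
  have -> : W ^+ m = \prod_(i < m) W by rewrite prodr_const card_ord.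
  apply: ler_prod => j _; rewrite normr_ge0 /=.
  have := le_kw_size p j; rewrite -/U -!nat1r.
  move: (p.1 j)%:R (p.2 j)%:R (ler0n rat (p.1 j)) (ler0n rat (p.2 j)).
  move=> k r k0 r0 leU; have kr0 : 0 <= k * r by rewrite mulr_ge0.
  have b1 : 1 + 2 * r <= 2 * U by lra.
  have b2 : 1 + r + k <= U by lra.
  rewrite ger0_norm ?mulr_ge0 //; try lra.
  apply: (@le_trans _ _ (2 * U * U)); first by apply: ler_pM => //; lra.
  rewrite /W -mulrA -expr2 ler_wpM2l // ler_weXn2l //.
Qed.

Lemma sum_uniq_ge (s : seq nat) : uniq s -> ((size s * (size s - 1))./2 <= \sum_(x <- s) x)%N.
Proof.
have [n] := ubnP (size s); elim: n s => // n IHn s; rewrite ltnS => sn us.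
case: (posnP (size s)) => [->//|s0].
(* Pigeonhole; removing such an x leaves the bound for one element fewer. *)
have [x xs xge] : exists2 x, x \in s & ((size s).-1 <= x)%N.
  apply: contrapT => nx; have : (size s <= size (iota 0 (size s).-1))%N.
    apply: uniq_leq_size => // x xs; rewrite mem_iota add0n ltnNge.
    by apply/negP => xge; apply: nx; exists x.
  by rewrite size_iota; case: (size s) s0 => // k _; rewrite ltnn.
rewrite (perm_big _ (perm_to_rem xs)) big_cons.
have := IHn (rem x s); rewrite size_rem // rem_uniq // => /(_ _ isT).
have lt_n : ((size s).-1 < n)%N by case: (size s) s0 sn.
move=> /(_ lt_n) le_rem; apply: leq_trans (leq_add xge le_rem).
rewrite !subn1 -!bin2.
by case: (size s) s0 => // k _; rewrite /= binS bin1 addnC.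
Qed.

(** The factors r_i - r_j make the r_j distinct, so their sum is at least 0 + 1 + ... + (m-1). *)
Lemma kw_coef_neq0_weight p : kw_coef p != 0 -> ((m * (m - 1))./2 <= kw_weight p)%N.
Proof.
move=> c0; have r_inj : injective p.2.
  have lt_neq (i j : 'I_m) : (i < j)%N -> p.2 i != p.2 j.
    move=> ij; apply: contra c0 => /eqP rij; apply/eqP; rewrite /kw_coef.
    rewrite [X in _ * X * _](bigD1 i) //= [X in _ * (X * _) * _](bigD1 j) //=.
    by rewrite rij subrr !(mulr0, mul0r).
  move=> i j rij; apply/eqP/negPn/negP; rewrite -val_eqE /= neq_ltn.
  by case/orP => /lt_neq; rewrite rij eqxx.
have := @sum_uniq_ge (map p.2 (enum 'I_m)).
rewrite size_map size_enum_ord map_inj_uniq // enum_uniq => /(_ isT) /leq_trans; apply.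
by rewrite big_map big_enum; apply: leq_sum => j _; rewrite leq_addl.
Qed.

Lemma kw_expo_coef_neq0 p : kw_coef p != 0 ->
  (kw_weight p = `|kw_expo p| + (m * (m - 1))./2)%N.
Proof. by move/kw_coef_neq0_weight => le_w; rewrite kw_expoE; lia. Qed.

Lemma finite_kw_fibre n : finite_set [set p : index | `|kw_expo p|%N = n]%classic.
Proof.
pose N := (n + (m * (m - 1))./2).+1.
pose h (x : {ffun 'I_m -> 'I_N} * {ffun 'I_m -> 'I_N}) : index :=
  ([ffun j => x.1 j : nat], [ffun j => x.2 j : nat]).
apply: (@sub_finite_set _ _ (h @` [set: _])%classic); last first.
  by apply: finite_image; exact: finite_finset.
move=> p /= pn; have wN : (kw_weight p < N)%N by move: pn; rewrite kw_expoE /N; lia.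
have le_w j : (p.1 j < N)%N /\ (p.2 j < N)%N.
  move: wN; rewrite /kw_weight (bigD1 j) //= => wN; nia.
exists ([ffun j => inord (p.1 j)], [ffun j => inord (p.2 j)]) => //.
case: p {pn wN} le_w => k r /= le_w; congr pair; apply/ffunP => j;
  by rewrite !ffunE inordK //; case: (le_w j).
Qed.

(** The absolute value only adds points of negative exponent to the fibre, and their coefficients
    vanish. *)
Lemma kw_seriesE n : kw_series m (Posz n) =
  (norm_const rat m)^-1 * \sum_(p \in [set p : index | `|kw_expo p|%N = n]%classic) kw_coef p.
Proof.
congr (_ * _); apply: fsbig_widen => [p /= -> //|p /= [pn pnn]].
apply: contrapT => /eqP /kw_coef_neq0_weight le_w; apply: pnn.
by move: pn; rewrite kw_expoE; lia.
Qed.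

Lemma kw_series_neg n : kw_series m (Negz n) = 0.
Proof.
rewrite /kw_series /formal_sum fsbig1 ?mulr0 // => p /= pn.
apply: contrapT => /eqP /kw_coef_neq0_weight le_w.
by move: pn; rewrite kw_expoE; lia.
Qed.

End SeriesKW.

(** * Power series in the unit disc *)

Section PowerSeries.
Variable R : realType.
Local Open Scope complex_scope.
Implicit Type z : R[i].

Lemma sumr_fset_nat_le (g : nat -> R) (B : R) :
  (forall n, 0 <= g n) -> (forall n, \sum_(k < n) g k <= B) ->
  forall A : {fset nat}, \sum_(k <- A) g k <= B.
Proof.
move=> g0 gB A; pose N := (\max_(k <- A) k).+1; apply: le_trans (gB N).
rewrite (big_ord_fset g).
by apply: sumr_fset_le => //; exact: fsubset_ord.
Qed.

Lemma ratr_complex (x : rat) : (ratr x : R)%:C = ratr x.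
Proof. exact: (fmorph_rat (real_complex R)). Qed.

Lemma norm_ratr_complex (x : rat) : `|ratr x : R[i]| = (ratr `|x| : R)%:C.
Proof. by rewrite ratr_complex ratr_norm. Qed.

Lemma ratr_fsbig (I : choiceType) (P : set I) (F : I -> rat) :
  finite_set P -> @ratr R[i] (\sum_(i \in P) F i) = \sum_(i \in P) @ratr R[i] (F i).
Proof. by move=> finP; rewrite !fsbig_finite // rmorph_sum. Qed.

Lemma asum_triangle z rho : `|z| = rho%:C -> 0 < rho < 1 ->
  asum (fun n => ratr (triangle_fps n) * z ^+ n) (triangle z).
Proof.
move=> zr rho01; have /andP[r0 r1] := rho01; pose e n := (n * n.+1)./2.
have le_e n : (n <= e n)%N.
  rewrite /e mulnS -[n in (n <= _)%N]half_double; apply: half_leq.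
  by case: n => // n; rewrite -muln2; nia.
have [s hs] : exists s, asum (fun n => z ^+ e n) s.
  apply: (@asum_exists _ _ _ (1 - rho)^-1) => A.
  under eq_bigr do rewrite normrX zr -rmorphXn.
  rewrite -rmorph_sum lecR.
  apply: (@le_trans _ _ (\sum_(n <- A) rho ^+ n)).
    by apply: ler_sum => n _; apply: ler_wiXn2l; rewrite ?le_e // ltW.
  apply: sumr_fset_nat_le => n; last exact: geometric_sum_le.
  by rewrite exprn_ge0 // ltW.
rewrite /triangle (asum_series hs).
have fin_e n : finite_set [set k | e k = n]%classic.
  apply: sub_finite_set (finite_II n.+1) => k /= <-.
  by rewrite ltnS.
apply: eq_asum (asum_fibre fin_e hs) => n.
rewrite /triangle_fps /formal_sum ratr_fsbig // mulr_fsuml.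
by apply: eq_fsbigr => k; rewrite inE /= => <-; rewrite rmorph1 mul1r.
Qed.

Lemma asum_kw_terms m z rho : `|z| = rho%:C -> 0 < rho < 1 ->
  exists S, asum (fun p => ratr (@kw_coef m p) * z ^+ `|kw_expo p|) S.
Proof.
move=> zr rho01; have /andP[r0 r1] := rho01.
pose D := (m * m + m)%N; pose T := ((m * (m - 1))./2).
pose g (n : nat) : R := n.+1%:R ^+ (4 * D) * rho ^+ n.
have g0 n : 0 <= g n by rewrite mulr_ge0 ?exprn_ge0 // ltW.
have [B gB] := @polynomial_geometric_sum_le _ rho (4 * D)%N rho01.
have sum_g := @sumr_fset_ffun_le _ m g B g0 gB.
pose G (f : {ffun 'I_m -> nat}) := \prod_(j < m) g (f j).
have G0 f : 0 <= G f by exact: prodr_ge0.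
have sum_G (A : {fset {ffun 'I_m -> nat}}) : \sum_(f <- A) `|G f| <= B ^+ m.
  by under eq_bigr do rewrite ger0_norm //; exact: sum_g.
(* 2^D comes from [norm_kw_coef_le]; rho^-T pays for the shift of the exponent by T. *)
pose C : R := 2 ^+ D * rho ^- T.
have C0 : 0 <= C by rewrite mulr_ge0 ?invr_ge0 ?exprn_ge0 // ltW.
apply: (@asum_exists _ _ _ (C * (B ^+ m * B ^+ m))) => A.
apply: (@le_trans _ _ (\sum_(p <- A) (C * `|G p.1 * G p.2|)%:C)); last first.
  rewrite -rmorph_sum lecR -mulr_sumr; apply: ler_wpM2l => //.
  exact: bounded_sumM.
apply: ler_sum => p _.
rewrite normrM normrX zr norm_ratr_complex -rmorphXn -rmorphM lecR.
rewrite [X in C * X]ger0_norm ?mulr_ge0 //.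
have GG : G p.1 * G p.2 = ratr (kw_size p) ^+ (4 * D) *
    rho ^+ (\sum_(j < m) (p.1 j + p.2 j))%N.
  rewrite /G /kw_size rmorph_prod -prodrXl expr_sum -!big_split /=.
  apply: eq_bigr => j _; rewrite /g rmorphM /= !ratr_nat exprMn exprD; ring.
have coef_le : ratr `|kw_coef p| <= 2 ^+ D * ratr (kw_size p) ^+ (4 * D) :> R.
  rewrite exprM -exprMn -rmorphXn -[2](ratr_nat R 2) -rmorphM -rmorphXn ler_rat.
  exact: norm_kw_coef_le.
have rho_le : rho ^+ `|kw_expo p| <= rho ^- T * rho ^+ (\sum_(j < m) (p.1 j + p.2 j))%N.
  rewrite ler_pdivlMl ?exprn_gt0 // -exprD; apply: ler_wiXn2l; rewrite ?ltW //.
  apply: (@leq_trans (kw_weight p)); last by rewrite kw_expoE -/T; lia.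
  apply: leq_sum => j _; rewrite leq_add2r; apply: leq_trans (leq_addl _ _).
  by rewrite mul2n -addnn leq_addr.
rewrite GG; apply: le_trans (ler_pM _ _ coef_le rho_le) _.
- by rewrite ler0q.
- by rewrite exprn_ge0 // ltW.
- by rewrite /C le_eqVlt; apply/orP; left; apply/eqP; ring.
Qed.

Lemma asum_kw_series m z S :
  asum (fun p => ratr (@kw_coef m p) * z ^+ `|kw_expo p|) S ->
  asum (fun n => ratr (kw_series m (Posz n)) * z ^+ n) ((norm_const R[i] m)^-1 * S).
Proof.
move=> hS; have normE : norm_const R[i] m = ratr (norm_const rat m).
  by rewrite /norm_const rmorphM rmorphXn rmorph_prod /= ratr_nat; congr (_ * _ ^+ _);
    apply: eq_bigr => j _; rewrite ratr_nat.
apply: eq_asum (asumZ _ (asum_fibre (@finite_kw_fibre m) hS)) => n.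
rewrite kw_seriesE rmorphM /= fmorphV normE -mulrA; congr (_ * _).
rewrite ratr_fsbig; last exact: finite_kw_fibre.
by rewrite mulr_fsuml; apply: eq_fsbigr => p; rewrite inE /= => <-.
Qed.

(* Isolating the first nonzero coefficient [c k], the rest of the series is
   O(x^(k+1)) as x tends to 0. *)
Lemma power_series_eq0 (c : nat -> R[i]) :
  (forall x : R, 0 < x < 1 -> asum (fun n => c n * x%:C ^+ n) 0) ->
  forall n, c n = 0.
Proof.
move=> hc k; elim/ltn_ind: k => k IHk.
have half01 : 0 < (1 / 2 : R) < 1 by apply/andP; split; lra.
have half0 : 0 <= (1 / 2 : R) by lra.
have [M cM] := asum_bounded (hc _ half01).
have M0 : 0 <= M by have := cM fset0; rewrite big_seq_fset0 lecR.
pose gam := complex.Re `|c k|.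
have gamE : `|c k| = gam%:C by rewrite RRe_real // normr_real.
have gam0 : 0 <= gam by rewrite -ler0c -gamE normr_ge0.
(* M bounds the sums of |c n| / 2^n, and x^n = (2x)^n / 2^n <= (2x)^(k+1) / 2^n for n > k. *)
have bound (x : R) : 0 < x <= 1 / 2 -> gam * x ^+ k <= (2 * x) ^+ k.+1 * M.
  move=> /andP[x0 x12]; apply/ler_addgt0Pr => e e0.
  have x01 : 0 < x < 1 by apply/andP; split; lra.
  have [|A HA] := asum_cvg (hc x x01) (e := e%:C); first by rewrite ltcR.
  have := HA (k |` A)%fset (fsubsetU1 _ _).
  rewrite (big_fsetD1 k) ?fset1U1 //= sub0r normrN; set r := \sum_(i <- _) _.
  have rle : `|r| <= ((2 * x) ^+ k.+1 * M)%:C.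
    apply: le_trans (ler_norm_sum _ _ _) _.
    rewrite rmorphM; apply: le_trans (ler_wpM2l _ (cM ((k |` A) `\ k)%fset)); last first.
      by rewrite ler0c exprn_ge0 //; lra.
    rewrite mulr_sumr big_seq [leRHS]big_seq; apply: ler_sum => n.
    rewrite !inE => /andP[nk _]; have [n_lt|k_lt|/eqP] := ltngtP n k.
    - by rewrite IHk // !mul0r normr0 mulr0.
    - rewrite !normrM mulrCA ler_wpM2l // !normrX !ger0_norm ?ler0c ?(ltW x0) //.
      rewrite -!rmorphXn -rmorphM lecR [in leLHS](_ : x = 2 * x * (1 / 2)); last by field.
      rewrite exprMn ler_wpM2r ?exprn_ge0 //.
      by apply: ler_wiXn2l => //; lra.
    - by rewrite (negPf nk).
  move=> small; rewrite -lecR rmorphD /= -lerBlDl.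
  have -> : (gam * x ^+ k)%:C = `|c k * x%:C ^+ k|.
    by rewrite rmorphM /= -gamE normrM normrX rmorphXn /= (@ger0_norm _ x%:C) // ler0c ltW.
  apply: le_trans (lerB (lexx _) rle) _; apply: le_trans (ltW small).
  by have := ler_normB (c k * x%:C ^+ k + r) r; rewrite addrK -lerBlDr.
have [gam_le0|gam_gt0] := leP gam 0.
  apply/eqP; rewrite -normr_eq0 gamE; apply/eqP; congr _%:C.
  by apply/le_anti/andP.
pose q : R := 2 ^+ k.+1; have q0 : 0 < q by rewrite exprn_gt0.
have qM0 : 0 <= q * M by rewrite mulr_ge0 // ltW.
(* For x = gam / d, the summand 2 gam gives x <= 1/2, while [bound] would give d <= q M, which d
   exceeds. *)
pose d := 2 * (q * M + q) + 2 * gam; have d0 : 0 < d by rewrite /d; lra.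
pose x := gam / d; have x0 : 0 < x by exact: divr_gt0.
have x12 : x <= 1 / 2 by rewrite ler_pdivrMr // /d; lra.
have := bound x; rewrite x0 x12 => /(_ isT).
have -> : (2 * x) ^+ k.+1 * M = q * x * M * x ^+ k by rewrite exprMn -/q exprS; ring.
rewrite ler_pM2r ?exprn_gt0 //.
have xd : x * d = gam by rewrite divfK // gt_eqF.
move: x x0 xd {x12} => x x0 <-; rewrite [q * x]mulrC -[x * q * M]mulrA ler_pM2l //.
by rewrite /d => le_d; exfalso; lra.
Qed.

End PowerSeries.

(** * The lattice sum *)

Section KWSum.
Variables (R : realType) (m : nat).
Local Open Scope complex_scope.
Notation signs := ({ffun 'I_m -> bool} * {ffun 'I_m -> bool})%type.
Notation index := ({ffun 'I_m -> nat} * {ffun 'I_m -> nat})%type.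
Notation lattice := ({ffun 'I_m -> int} * {ffun 'I_m -> int})%type.

(* [half_int_index y] is the index r such that the half-integer y + 1/2 is
   r + 1/2 or - (r + 1/2). *)
Definition half_int_index (y : int) : nat :=
  match y with Posz n => n | Negz n => n end.

(* The points with |x_j| > |y_j| for all j, through their signs and the
   substitution |x_j| = k_j + r_j + 1, |y_j| = r_j + 1/2. *)
Definition lattice_of (u : signs * index) : lattice :=
  ([ffun j => (-1) ^+ (u.1.1 j) * (u.2.1 j + u.2.2 j).+1%:Z],
   [ffun j => if u.1.2 j then Negz (u.2.2 j) else Posz (u.2.2 j)]).

(** The subtraction truncates exactly where |x_j| < |y_j|, that is, outside the image of
    [lattice_of], where the terms vanish. *)
Definition index_of (p : lattice) : signs * index :=
  (([ffun j => p.1 j < 0], [ffun j => p.2 j < 0]),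
   ([ffun j => `|p.1 j| - (half_int_index (p.2 j)).+1]%N, [ffun j => half_int_index (p.2 j)])).

Lemma lattice_ofK : cancel lattice_of index_of.
Proof.
move=> [[s s'] [k r]]; rewrite /index_of /lattice_of /=; congr ((_, _), (_, _));
  apply/ffunP => j; rewrite !ffunE.
- by case: (s j); rewrite ?expr1 ?expr0; lia.
- by case: (s' j).
- case: (s j); case: (s' j); rewrite ?expr1 ?expr0 /=; lia.
- by case: (s' j).
Qed.

(** The hypothesis means |x| < |y + 1/2|, so both arguments have the sign of -(y + 1/2). *)
Lemma sg_diff_eq0 (x y : int) : (`|x| <= half_int_index y)%N ->
  Num.sg (x%:~R - (y%:~R + 1 / 2)) - Num.sg (- x%:~R - (y%:~R + 1 / 2)) = 0 :> R.
Proof.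
move=> le_xy.
have le_abs (n : nat) : (`|x| <= n)%N -> - n%:R <= (x%:~R : R) <= n%:R.
  move=> xn; rewrite -[n%:R]/(n%:Z%:~R) -rmorphN !ler_int; lia.
case: y le_xy => n /= /le_abs /andP[]; rewrite -?[n%:Z%:~R]/(n%:R) => ge_x le_x.
- by rewrite !ltr0_sg ?subrr //; lra.
- rewrite NegzE mulrNz -[n.+1%:Z%:~R]/(n.+1%:R) -natr1.
  by rewrite !gtr0_sg ?subrr //; lra.
Qed.

Lemma lattice_of_surj (tau : R[i]) (p : lattice) :
  KW_term tau p != 0 -> lattice_of (index_of p) = p.
Proof.
case: p => x y; rewrite /KW_term /= => nz.
have gt_xy j : (half_int_index (y j) < `|x j|)%N.
  rewrite ltnNge; apply: contra nz => /sg_diff_eq0 sg0.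
  by rewrite [X in X%:C * _](bigD1 j) //= sg0 !mul0r.
rewrite /lattice_of /index_of /=; congr pair; apply/ffunP => j; rewrite !ffunE.
- have := gt_xy j; case: (ltrP (x j) 0) => x0 /=; rewrite ?expr1 ?expr0; lia.
- by case: (y j).
Qed.

Definition lattice_x (u : signs * index) j : R :=
  (-1) ^+ (u.1.1 j) * (1 + (u.2.1 j)%:R + (u.2.2 j)%:R).
Definition lattice_y (u : signs * index) j : R :=
  (-1) ^+ (u.1.2 j) * ((u.2.2 j)%:R + 1 / 2).

Lemma lattice_xE u j : ((lattice_of u).1 j)%:~R = lattice_x u j.
Proof.
rewrite ffunE /lattice_x rmorphM rmorphXn rmorphN rmorph1 /=; congr (_ * _).
by rewrite -[LHS]/((_).+1%:R) -natr1 natrD; ring.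
Qed.

Lemma lattice_yE u j : ((lattice_of u).2 j)%:~R + 1 / 2 = lattice_y u j.
Proof.
rewrite ffunE /lattice_y; case: (u.1.2 j); rewrite ?expr0 ?mul1r ?expr1 //.
by rewrite NegzE mulrNz -[_%:Z%:~R]/((_).+1%:R) -natr1; field.
Qed.

(** As |x| > |y|, the two signs are sgn x and - sgn x. *)
Lemma sg_diff_lattice u j :
  Num.sg (lattice_x u j - lattice_y u j) - Num.sg (- lattice_x u j - lattice_y u j)
  = 2 * (-1) ^+ (u.1.1 j).
Proof.
rewrite /lattice_x /lattice_y; move: (u.2.1 j)%:R (u.2.2 j)%:R
  (ler0n R (u.2.1 j)) (ler0n R (u.2.2 j)) => k r k0 r0.
case: (u.1.1 j); case: (u.1.2 j); rewrite ?expr0 ?expr1 ?mul1r ?mulN1r.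
- by rewrite ltr0_sg ?gtr0_sg; lra.
- by rewrite ltr0_sg ?gtr0_sg; lra.
- by rewrite gtr0_sg ?ltr0_sg; lra.
- by rewrite gtr0_sg ?ltr0_sg; lra.
Qed.

(** Modulo 2 the sign of x_j is irrelevant, and a negative y_j replaces r_j by r_j + 1. *)
Lemma sign_lattice u j : (-1) ^ ((lattice_of u).1 j - (lattice_of u).2 j - 1)
  = (-1) ^+ (u.1.2 j) * (-1) ^+ (u.2.1 j) :> R[i].
Proof.
set z := _ - 1; have -> : (-1) ^ z = (-1) ^+ odd `|z|%N :> R[i].
  by rewrite signr_odd; case: z => n //=; rewrite /exprz -exprVn invrN1.
rewrite -exprD -[RHS]signr_odd; congr (_ ^+ nat_of_bool _).
rewrite /z !ffunE; move: (u.2.1 j) (u.2.2 j) => k r.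
case: (u.1.1 j); case: (u.1.2 j); rewrite ?expr0 ?expr1 ?mul1r ?mulN1r; lia.
Qed.

End KWSum.

(** * Evaluation of the lattice sum by the series in (i) *)

Section KWValue.
Variables (R : realType) (m : nat).
Local Open Scope complex_scope.
Notation signs := ({ffun 'I_m -> bool} * {ffun 'I_m -> bool})%type.
Notation index := ({ffun 'I_m -> nat} * {ffun 'I_m -> nat})%type.
Implicit Types (u : signs * index) (tau : R[i]).

Lemma ratr_kw_coef (p : index) :
  let k (j : 'I_m) : R := (p.1 j)%:R in
  let r (j : 'I_m) : R := (p.2 j)%:R in
  ratr (kw_coef p) =
  (\prod_(i < m) \prod_(j < m | (i < j)%N)
     ((r i + k i - r j - k j) * (r i - r j) *
      (2 + r i + k i + r j + k j) * (1 + r i + r j))) *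
  \prod_(j < m) ((-1) ^+ p.1 j * ((1 + 2 * r j) * (1 + r j + k j))).
Proof.
move=> k r; rewrite big_split /= -expr_sum mulrA [_ * (-1) ^+ _]mulrC.
rewrite /kw_coef !rmorphM rmorphXn rmorphN rmorph1 /= !rmorph_prod.
congr (_ * _ * _); apply: eq_bigr => i _.
  rewrite rmorph_prod; apply: eq_bigr => j _.
  by rewrite !rmorphM /= !(rmorphB, rmorphD) /= !ratr_nat rmorph1.
by rewrite rmorphM !rmorphD rmorphM /= !ratr_nat rmorph1.
Qed.

(** All signs get squared, and 2 |x_j| |y_j| = (1 + r_j + k_j)(1 + 2r_j). The differences of squares
    factor into the four factors of [kw_coef]. *)
Lemma Vm_lattice u :
  (\prod_(j < m) (2 * (-1) ^+ (u.1.1 j))) * Vm (lattice_x R u) (lattice_y R u) *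
  \prod_(j < m) ((-1) ^+ (u.1.2 j) * (-1) ^+ (u.2.1 j)) = ratr (kw_coef u.2).
Proof.
have reorder (a p d e : R) : a * (p * d) * e = p * (a * d * e) by ring.
rewrite ratr_kw_coef /Vm reorder; congr (_ * _).
  apply: eq_bigr => i _; apply: eq_bigr => j _.
  rewrite /lattice_x /lattice_y !exprMn !sqrr_sign !mul1r; by field.
rewrite -!big_split /=; apply: eq_bigr => j _; rewrite /lattice_x /lattice_y.
have := sqrr_sign R (u.1.1 j); have := sqrr_sign R (u.1.2 j).
set a := (-1) ^+ u.1.1 j; set b := (-1) ^+ u.1.2 j => b2 a2.
transitivity (a ^+ 2 * b ^+ 2 * (-1) ^+ u.2.1 j *
  ((1 + 2 * (u.2.2 j)%:R) * (1 + (u.2.2 j)%:R + (u.2.1 j)%:R))); first by field.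
by rewrite a2 b2 !mul1r.
Qed.

(** x_j^2 - y_j^2 = k_j^2 + 2k_j r_j + 2k_j + r_j + 3/4, whence 3/8 per coordinate. *)
Lemma prod_qpow_lattice tau u :
  \prod_(j < m) qpow tau (1 / 2 * (lattice_x R u j ^+ 2 - lattice_y R u j ^+ 2)) =
  qpow tau (1 / 2) ^+ kw_weight u.2 * qpow tau (m%:R * (3 / 8)).
Proof.
rewrite -qpow_natl -qpowD -qpow_sum; congr qpow.
have -> : m%:R * (3 / 8) = \sum_(j < m) (3 / 8) :> R by rewrite sumr_const card_ord mulr_natl.
rewrite /kw_weight natr_sum mulr_suml -big_split /=.
apply: eq_bigr => j _; rewrite /lattice_x /lattice_y !exprMn !sqrr_sign !mul1r.
by rewrite !natrD !natrM; field.
Qed.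

Lemma KW_term_lattice tau u : KW_term tau (lattice_of u) =
  qpow tau ((m * (2 * m + 1))%:R / 8) *
  (ratr (kw_coef u.2) * qpow tau (1 / 2) ^+ `|kw_expo u.2|).
Proof.
have -> : KW_term tau (lattice_of u) =
    (ratr (kw_coef u.2) : R)%:C *
    (qpow tau (1 / 2) ^+ kw_weight u.2 * qpow tau (m%:R * (3 / 8))).
  rewrite -Vm_lattice -prod_qpow_lattice.
  move: (lattice_xE R u) (lattice_yE R u) (sign_lattice R u) (sg_diff_lattice R u).
  move: (lattice_of u) => p xE yE signE sgE; rewrite /KW_term.
  rewrite (_ : (fun j => (p.1 j)%:~R) = lattice_x R u); last by apply/funext.
  rewrite (_ : (fun j => (p.2 j)%:~R + 1 / 2) = lattice_y R u); last by apply/funext.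
  move: (Vm _ _) => V; rewrite [in RHS]rmorphM rmorphM /= -!mulrA; congr (_ * (_ * _)).
    by congr _%:C; apply: eq_bigr => j _; rewrite xE yE sgE.
  rewrite rmorph_prod -big_split; apply: eq_bigr => j _ /=.
  by rewrite xE yE signE rmorphM !rmorphXn rmorphN rmorph1 mulrC.
(* Zero coefficients are set aside, since there the exponent may be negative and differ from its
   absolute value. *)
rewrite ratr_complex; have [->|c0] := eqVneq (kw_coef u.2) 0.
  by rewrite rmorph0 !(mul0r, mulr0).
(* m(2m+1)/8 = m(m-1)/4 + 3m/8: the shift of the exponent in (i) and the constants 3/8. *)
have -> : qpow tau ((m * (2 * m + 1))%:R / 8) =
    qpow tau (1 / 2) ^+ (m * (m - 1))./2 * qpow tau (m%:R * (3 / 8)).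
  rewrite -qpow_natl -qpowD; congr qpow.
  have : ((m * (m - 1))./2.*2 + m = m * m)%N.
    by rewrite even_halfK; case: m => // n; rewrite ?subn1 ?oddM /= ?andNb //; lia.
  move/(congr1 (fun n => n%:R : R)); rewrite -muln2 !natrD !natrM => h; lra.
by rewrite (kw_expo_coef_neq0 c0) exprD; ring.
Qed.

(** The terms do not depend on the signs, so the sum factors through the finite set of 4^m sign
    choices. *)
Lemma KW_eq tau S :
  asum (fun p => ratr (@kw_coef m p) * qpow tau (1 / 2) ^+ `|kw_expo p|) S ->
  KW m tau = qpow tau ((m * (2 * m + 1))%:R / 8) * ((norm_const R[i] m)^-1 * S).
Proof.
move=> hS; set Q := qpow tau (_ / 8).
have signs_sum : \sum_(s : signs) (1 : R[i]) = 4 ^+ m.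
  rewrite sumr_const card_prod !card_ffun card_bool card_ord natrM !natrX -exprMn.
  by congr (_ ^+ _); ring.
have := asumZ Q (asum_mul (asum_finite (fun s : signs => 1 : R[i])) hS).
rewrite signs_sum => hQ.
have hKW : asum (KW_term (m := m) tau) (Q * (4 ^+ m * S)).
  apply: (asum_reindex (@lattice_ofK m)) => [p|]; first exact: lattice_of_surj.
  by apply: eq_asum hQ => u /=; rewrite KW_term_lattice mul1r.
rewrite /KW (asum_sum hKW) -mulrA; set c := (norm_const _ _)^-1.
have -> : c * (Q * (4 ^+ m * S)) = 4 ^+ m * (Q * (c * S)) by ring.
by rewrite mulKf // expf_neq0 // pnatr_eq0.
Qed.

End KWValue.

Theorem theorem4p3 (R : realType) (m : nat) (hm : (0 < m)%N) :
  (forall N : int,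
     laurent_of_fps (fps_exp triangle_fps (2 * m * (2 * m + 1))%N) N
     = kw_series m N)
  <->
  (forall tau : R[i], 0 < complex.Im tau ->
     theta_triangle tau ^+ (2 * m * (2 * m + 1))%N = KW m tau).
Proof.
set d := (2 * m * (2 * m + 1))%N.
pose lhs z (n : nat) : R[i] := ratr (fps_exp triangle_fps d n) * z ^+ n.
pose rhs z (n : nat) : R[i] := ratr (kw_series m (Posz n)) * z ^+ n.
have reduce (tau : R[i]) : 0 < complex.Im tau -> exists S,
    [/\ asum (lhs (qpow tau (1 / 2))) (triangle (qpow tau (1 / 2)) ^+ d),
        asum (rhs (qpow tau (1 / 2))) S &
        theta_triangle tau ^+ d = KW m tau <-> triangle (qpow tau (1 / 2)) ^+ d = S].
  move=> tau0; pose rho := expR (- (2 * pi * (1 / 2) * complex.Im tau)) : R.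
  have norm_rho := norm_qpow tau (1 / 2).
  have rho01 : 0 < rho < 1.
    rewrite expR_gt0 -[ltRHS]expR0 ltr_expR oppr_lt0 !mulr_gt0 ?pi_gt0 //.
    by rewrite invr_gt0.
  have [S hS] := asum_kw_terms m norm_rho rho01.
  exists ((norm_const R[i] m)^-1 * S); split.
  - exact/asum_fps_exp/(asum_triangle norm_rho rho01).
  - exact: asum_kw_series.
  - rewrite (KW_eq hS) /theta_triangle exprMn -qpow_natl.
    have -> : d%:R * (1 / 16) = (m * (2 * m + 1))%:R / 8 :> R.
      by rewrite /d -mulnA natrM; field.
    by split=> [|->//]; apply: mulfI; exact: qpow_neq0.
split=> [coef_eq tau tau0|fun_eq].
  have [S [hl hr ->]] := reduce tau tau0; apply: asum_unique hl _.
  by apply: eq_asum hr => n; rewrite /rhs -coef_eq.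
case=> n; last by rewrite kw_series_neg.
apply/eqP; rewrite -subr_eq0 -(fmorph_eq0 (@ratr R[i])); apply/eqP.
apply: (@power_series_eq0 R (fun n => ratr (fps_exp triangle_fps d n - kw_series m n)%R)).
move=> x /andP[x0 x1].
(* The point of the imaginary axis with e^(pi i tau) = x. *)
pose tau : R[i] := Complex 0 (- ln x / pi).
have pi0 : pi != 0 :> R by rewrite gt_eqF ?pi_gt0.
have tau0 : 0 < complex.Im tau by rewrite divr_gt0 ?pi_gt0 // oppr_gt0 ln_lt0 // x0.
have qx : qpow tau (1 / 2) = (x%:C)%C.
  rewrite /qpow /cexp /= !(mul0r, mulr0) addr0 sub0r cos0 sin0 mulr0 mulr1.
  congr (Complex _ 0); rewrite -[RHS]lnK ?posrE //; congr expR.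
  by move: pi pi0 (ln x) {tau tau0} => p p0 l; field.
have [S [hl hr [/(_ (fun_eq _ tau0)) eqS _]]] := reduce tau tau0.
rewrite qx in hl hr eqS; have := asumB hl hr; rewrite eqS subrr.
by apply: eq_asum => k; rewrite rmorphB mulrBl.
Qed.
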